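(* Let $k\in\mathbb{Z}$ and $\{Q_j\}_{j\in\mathbb{N}}\in\Pi_\ell$ with $\ell\in(2^{-k-1},2^{-k}]$. Then $\{Q_j\}_{j\in\mathbb{N}}$ can be divided into $6^n$ subfamilies $\{\mathcal{Q}_m\}_{m=1}^{6^n}$ (possibly empty for some $m$) such that (i) $\{Q_j\}_{j\in\mathbb{N}}=\bigcup_{m=1}^{6^n}\mathcal{Q}_m$; (ii) for any $m\in\{1,\dots,6^n\}$, all cubes in $\{Q^\flat:\ Q\in\mathcal{Q}_m\}$ are mutually disjoint, that is, $Q^\flat\cap R^\flat=\emptyset$ for any two distinct $Q,R\in\mathcal{Q}_m$, where $Q^\flat$ denotes the dominated cube of $Q$.
   Context: Here $n\in\mathbb{N}$, $n\ge1$. A cube has finite positive edge length and all its edges parallel to the coordinate axes, and need not be open or closed. For $\ell\in(0,\infty)$, $\Pi_\ell$ is the class of all collections $\{Q_j\}_j$ of cubes of $\mathbb{R}^n$ with pairwise disjoint interiors and equal edge length $\ell$. $\mathscr{D}_k(\mathbb{R}^n)$ is the set of all dyadic cubes $2^{-k}(\mathbf{j}+[0,1)^n)$, $\mathbf{j}\in\mathbb{Z}^n$. Two sets $A,B\subset\mathbb{R}^n$ are mutually adjacent if $\overline A\cap\overline B\ne\emptyset$. Dominated cube: let $k\in\mathbb{Z}$ and let $Q$ be a cube of edge length $\ell\in(2^{-k-1},2^{-k}]$. There exist mutually adjacent dyadic cubes $\{Q^{(i)}\}_{i=1}^{2^n}\subset\mathscr{D}_k(\mathbb{R}^n)$ (forming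 a $2\times\cdots\times2$ block), with $Q^{(1)}$ being the left and lower one among them (the one whose coordinates are smallest), such that $Q\cap Q^{(1)}\ne\emptyset$ and $Q\subset\bigcup_{i=1}^{2^n}Q^{(i)}$. The dominated cube of $Q$ is $Q^\flat:=\bigcup_{i=1}^{2^n}Q^{(i)}$. *)

(* Defs.v *)
From HB Require Import structures.
From mathcomp Require Import all_boot all_order all_algebra.
From mathcomp Require Import all_classical all_reals all_analysis.
From mathcomp Require Import lra zify.

Set Implicit Arguments.
Unset Strict Implicit.
Unset Printing Implicit Defensive.

Import Order.TTheory GRing.Theory Num.Theory.
Import numFieldNormedType.Exports.

Local Open Scope classical_set_scope.
Local Open Scope ring_scope.

Section Cubes.
Context {R : realType} {n : nat}.

Definition open_box (a : 'rV[R]_n) (l : R) : set 'rV[R]_n :=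
  [set x | forall i, a 0 i < x 0 i < a 0 i + l].

Definition closed_box (a : 'rV[R]_n) (l : R) : set 'rV[R]_n :=
  [set x | forall i, a 0 i <= x 0 i <= a 0 i + l].

(* A cube may contain an arbitrary part of its boundary. *)
Definition cube_of_edge (l : R) (Q : set 'rV[R]_n) : Prop :=
  0 < l /\ exists a, open_box a l `<=` Q /\ Q `<=` closed_box a l.

Definition Pi_class (l : R) : set (set (set 'rV[R]_n)) :=
  [set C | (forall Q, C Q -> cube_of_edge l Q) /\
           trivIset C (fun Q : set 'rV[R]_n => Q°)].

(* 2^-k (j + [0, 1)^n) *)
Definition dyadic_cube (k : int) (j : 'rV[int]_n) : set 'rV[R]_n :=
  [set x | forall i,
     2 ^ (- k) * (j 0 i)%:~R <= x 0 i < 2 ^ (- k) * ((j 0 i)%:~R + 1)].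

Definition adjacent (A B : set 'rV[R]_n) : Prop :=
  closure A `&` closure B !=set0.

(* [J i] is the integer corner of Q^(i); [i1] is the index of Q^(1).  Since the
   2^n dyadic cubes are distinct and mutually adjacent, they form a
   2 x ... x 2 block. *)
Definition is_dominated (k : int) (Q D : set 'rV[R]_n) : Prop :=
  exists (J : 'I_(2 ^ n) -> 'rV[int]_n) (i1 : 'I_(2 ^ n)),
    [/\ injective J,
        forall i i', adjacent (dyadic_cube k (J i)) (dyadic_cube k (J i')),
        forall i c, J i1 0 c <= J i 0 c,
        Q `&` dyadic_cube k (J i1) !=set0 &
        Q `<=` D /\ D = \bigcup_i dyadic_cube k (J i)].

Definition dominated (k : int) (Q : set 'rV[R]_n) : set 'rV[R]_n :=
  xget set0 (is_dominated k Q).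

End Cubes.

Section DominatedCube.
Context {R : realType} {n : nat}.
Implicit Types (Q D : set 'rV[R]_n) (j : 'rV[int]_n) (x : 'rV[R]_n).

Let scale_gt0 (k : int) : 0 < (2 : R) ^ (- k).
Proof. by rewrite exprz_gt0. Qed.

Lemma closure_dyadic_sub k j x : closure (dyadic_cube k j) x ->
  forall c, 2 ^ (- k) * (j 0 c)%:~R <= x 0 c <= 2 ^ (- k) * ((j 0 c)%:~R + 1).
Proof.
have s0 := scale_gt0 k => cx c; apply/andP; split; rewrite leNgt; apply/negP => lt.
- have /cx [y [/(_ c)/andP[y1 _] [_ /(_ 0 c)]]] :
    nbhs x (ball x (2 ^ (- k) * (j 0 c)%:~R - x 0 c)).
    by apply: nbhsx_ballx; rewrite subr_gt0.
  rewrite /ball /= => yx; have : `|x 0 c - y 0 c| < 2 ^ (- k) * (j 0 c)%:~R - x 0 c by [].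
  rewrite ltr_norml => /andP[]; lra.
- have /cx [y [/(_ c)/andP[_ y1] [_ /(_ 0 c)]]] :
    nbhs x (ball x (x 0 c - 2 ^ (- k) * ((j 0 c)%:~R + 1))).
    by apply: nbhsx_ballx; rewrite subr_gt0.
  rewrite /ball /= => yx.
  have : `|x 0 c - y 0 c| < x 0 c - 2 ^ (- k) * ((j 0 c)%:~R + 1) by [].
  rewrite ltr_norml => /andP[]; lra.
Qed.

Lemma sub_closure_dyadic k j x :
  (forall c, 2 ^ (- k) * (j 0 c)%:~R <= x 0 c <= 2 ^ (- k) * ((j 0 c)%:~R + 1)) ->
  closure (dyadic_cube k j) x.
Proof.
have s0 := scale_gt0 k => bx B /nbhs_ballP[e /= e0 eB].
pose d := Num.min (e / 2) (2 ^ (- k) / 2).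
have d0 : 0 < d by rewrite lt_min; apply/andP; split; lra.
have de : d <= e / 2 by rewrite ge_min lexx.
have ds : d <= 2 ^ (- k) / 2 by rewrite ge_min lexx orbT.
exists (\row_c (if x 0 c < 2 ^ (- k) * ((j 0 c)%:~R + 1) then x 0 c else x 0 c - d)).
split.
  move=> c; rewrite mxE; have /andP[x1 x2] := bx c.
  case: ltP => [x3|x3]; first by rewrite x1.
  apply/andP; split; lra.
apply: eB; split=> [//|i c]; rewrite ord1 mxE.
have h (u : R) : `|x 0 c - u| < e -> ball (x 0 c) e u by [].
by case: ltP => _; apply: (h); rewrite ltr_norml; apply/andP; split; lra.
Qed.

Let card_bools : #|{ffun 'I_n -> bool}| = (2 ^ n)%N.
Proof. by rewrite card_ffun card_bool card_ord. Qed.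

Let bits (i : 'I_(2 ^ n)) : {ffun 'I_n -> bool} :=
  enum_val (cast_ord (esym card_bools) i).

Lemma is_dominated_ex k l Q : l <= 2 ^ (- k) -> cube_of_edge l Q ->
  exists D, is_dominated k Q D.
Proof.
have s0 := scale_gt0 k => ls [l0 [a [oQ Qc]]].
pose f c : int := Num.floor (a 0 c / 2 ^ (- k)).
have f1 c : 2 ^ (- k) * (f c)%:~R <= a 0 c.
  by rewrite mulrC -ler_pdivlMr // floor_le.
have f2 c : a 0 c < 2 ^ (- k) * ((f c)%:~R + 1).
  rewrite mulrC -ltr_pdivrMr //; have := floorD1_gt (a 0 c / 2 ^ (- k)).
  by rewrite intrD.
pose J i : 'rV[int]_n := \row_c (f c + (bits i c : nat)%:Z).
have Jb (e : {ffun 'I_n -> bool}) : exists i, bits i = e.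
  exists (cast_ord card_bools (enum_rank e)).
  by rewrite /bits cast_ordK enum_rankK.
have [i1 bi1] := Jb [ffun => false].
have i1J c : J i1 0 c = f c by rewrite mxE bi1 ffunE addr0.
exists (\bigcup_i dyadic_cube k (J i)), J, i1; split.
- move=> i i' /matrixP e; have : bits i = bits i'.
    apply/ffunP => c; have := e 0 c; rewrite !mxE => /addrI.
    by case: (bits i c) (bits i' c) => [] [].
  by move=> /enum_val_inj /cast_ord_inj.
- move=> i i'; exists (\row_c (2 ^ (- k) * ((f c)%:~R + 1))).
  have h t : closure (@dyadic_cube R n k (J t)) (\row_c (2 ^ (- k) * ((f c)%:~R + 1))).
    apply: sub_closure_dyadic => c; rewrite !mxE intrD.
    by case: (bits t c) => /=; rewrite ?mulr1z ?mulr0z; apply/andP; split; lra.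
  by split.
- by move=> i c; rewrite i1J mxE lerDl.
- pose d c := Num.min (l / 2) ((2 ^ (- k) * ((f c)%:~R + 1) - a 0 c) / 2).
  have d0 c : 0 < d c by rewrite lt_min; have := f2 c => ?; apply/andP; split; lra.
  have dl c : d c <= l / 2 by rewrite ge_min lexx.
  have df c : d c <= (2 ^ (- k) * ((f c)%:~R + 1) - a 0 c) / 2 by rewrite ge_min lexx orbT.
  exists (\row_c (a 0 c + d c)); split.
    apply: oQ => c; rewrite mxE; have := d0 c; have := dl c => ? ?.
    by apply/andP; split; lra.
  move=> c; rewrite i1J mxE; have := d0 c; have := df c; have := f1 c; have := f2 c.
  by move=> ? ? ? ?; apply/andP; split; lra.
- split=> // x /Qc xa.
  have [i bi] := Jb [ffun c => 2 ^ (- k) * ((f c)%:~R + 1) <= x 0 c].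
  exists i => // c; rewrite mxE bi ffunE.
  have /andP[x1 x2] := xa c; move: (f1 c) (f2 c) => g1 g2.
  rewrite !intrD /=; case: (lerP (2 ^ (- k) * ((f c)%:~R + 1)) (x 0 c)) => /= ?;
    rewrite ?mulr1z ?mulr0z; apply/andP; split; lra.
Qed.

Lemma is_dominated_block k Q D (l : R) a :
  0 < l -> open_box a l `<=` Q -> Q `<=` closed_box a l -> is_dominated k Q D ->
  D = [set x | forall c, 2 ^ (- k) * (Num.floor (a 0 c / 2 ^ (- k)))%:~R <= x 0 c
               < 2 ^ (- k) * ((Num.floor (a 0 c / 2 ^ (- k)))%:~R + 2)].
Proof.
have s0 := scale_gt0 k => l0 oQ Qc [J [i1 [Ji adj low [y [Qy y1]] [QD DJ]]]].
have Jle i c : J i 0 c <= J i1 0 c + 1.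
  have [z [zi zi1]] := adj i i1.
  have /andP[z1 _] := closure_dyadic_sub zi c.
  have /andP[_ z2] := closure_dyadic_sub zi1 c.
  rewrite -(ler_int R) intrD -(ler_pM2l s0); exact: le_trans z1 z2.
pose e i : {ffun 'I_n -> bool} := [ffun c => J i 0 c != J i1 0 c].
have Je i c : J i 0 c = J i1 0 c + (e i c : nat)%:Z.
  by rewrite ffunE; have := Jle i c; have := low i c; case: eqP => /=; lia.
have ei : injective e.
  move=> i i' ee; apply: Ji; apply/rowP => c; by rewrite (Je i) (Je i') ee.
have [g _ gK] : bijective e by apply: (inj_card_bij ei); rewrite card_bools card_ord.
have DE : D = [set x | forall c, 2 ^ (- k) * (J i1 0 c)%:~R <= x 0 c
                     < 2 ^ (- k) * ((J i1 0 c)%:~R + 2)].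
  rewrite DJ; apply/seteqP; split=> x /=.
    move=> [i _ xi] c; have /andP[] := xi c; rewrite Je intrD.
    by case: (e i c) => /=; rewrite ?mulr1z ?mulr0z => ? ?; apply/andP; split; lra.
  move=> xb; exists (g [ffun c => 2 ^ (- k) * ((J i1 0 c)%:~R + 1) <= x 0 c]) => // c.
  rewrite Je gK ffunE intrD; have /andP[? ?] := xb c.
  by case: (lerP (2 ^ (- k) * ((J i1 0 c)%:~R + 1)) (x 0 c)) => /= ?; rewrite ?mulr1z ?mulr0z; apply/andP; split; lra.
suff fE c : Num.floor (a 0 c / 2 ^ (- k)) = J i1 0 c.
  by rewrite DE; apply/seteqP; split=> x /= h c; have := h c; rewrite fE.
have f2 : a 0 c < 2 ^ (- k) * ((Num.floor (a 0 c / 2 ^ (- k)))%:~R + 1).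
  rewrite mulrC -ltr_pdivrMr //; have := floorD1_gt (a 0 c / 2 ^ (- k)).
  by rewrite intrD.
set f := Num.floor _ in f2 *.
have f1 : 2 ^ (- k) * f%:~R <= a 0 c.
  by rewrite mulrC -ler_pdivlMr // floor_le.
apply/eqP; rewrite eq_le -ltzD1; apply/andP; split.
  have /andP[ya _] := Qc _ Qy c; have /andP[_ yJ] := y1 c.
  rewrite -(ltr_int R) intrD -(ltr_pM2l s0); lra.
rewrite leNgt -lezD1 -(ler_int R) intrD; apply/negP => fJ.
pose d := Num.min (l / 2) ((2 ^ (- k) * (f%:~R + 1) - a 0 c) / 2).
have d0 : 0 < d by rewrite lt_min; apply/andP; split; lra.
have dl : d <= l / 2 by rewrite ge_min lexx.
have df : d <= (2 ^ (- k) * (f%:~R + 1) - a 0 c) / 2 by rewrite ge_min lexx orbT.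
have : D (\row_c' (a 0 c' + d)).
  by apply: QD; apply: oQ => c'; rewrite mxE; apply/andP; split; lra.
rewrite DE => /(_ c); rewrite mxE => /andP[+ _]; move: fJ; rewrite -(ler_pM2l s0); lra.
Qed.

(* The dominated cube exists and is unique, so the choice made by [dominated] is
   immaterial. *)
Lemma dominatedP k l Q : l <= 2 ^ (- k) -> cube_of_edge l Q ->
  forall D, is_dominated k Q D <-> D = dominated k Q.
Proof.
move=> ls cQ; have [D0 hD0] := is_dominated_ex ls cQ.
have h : is_dominated k Q (dominated k Q) by exact: (xgetPex set0 (ex_intro _ D0 hD0)).
move=> D; split=> [hD|->//].
case: cQ => l0 [a [h1 h2]].
by rewrite (is_dominated_block l0 h1 h2 hD) (is_dominated_block l0 h1 h2 h).
Qed.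
End DominatedCube.

(* Main.v *)
Require Import Defs.
From HB Require Import structures.
From mathcomp Require Import all_boot all_order all_algebra.
From mathcomp Require Import all_classical all_reals all_analysis.
From mathcomp Require Import lra zify.
Import Order.TTheory GRing.Theory Num.Theory.
Import numFieldNormedType.Exports.
Local Open Scope classical_set_scope.
Local Open Scope ring_scope.

(** Write [s = 2 ^ (- k)] and let [a] be the lower corner of a cube [A] of edge
    length [l], where [s / 2 < l <= s].  The dominated cube of [A] is the block
    [\prod_c [s f_c, s (f_c + 2))] with [f_c = floor (a_c / s)].  Subdivide
    space into the half-size dyadic cells, of edge [s / 2], and colour [A] by
    the residues modulo 6 of the coordinates [g_c = floor (2 a_c / s)] of the
    half cell that contains [a]; this uses [6 ^ n] colours.

    Let [A] and [B] have the same colour.  If their corners lie in the same half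
    cell, these corners differ by less than [s / 2 < l] in each coordinate, so
    the interiors of [A] and [B] meet ([interior_cubes_meet]), and [A = B]
    because the interiors of distinct cubes of the family are disjoint.
    Otherwise some [g_c] differ by a nonzero multiple of 6; as [g_c] is
    [2 f_c] or [2 f_c + 1], the [f_c] differ by at least 3, hence the two
    blocks, of width 2 in units of [s], are disjoint
    ([dominated_disjoint]). *)

Section CubeGeometry.
Set Implicit Arguments.
Unset Strict Implicit.
Context {R : realType} {n : nat}.
Implicit Types (A B : set 'rV[R]_n) (a b : 'rV[R]_n) (l : R) (k : int).

Lemma open_box_open a l : open (open_box a l).
Proof.
rewrite openE => x ax.
have ev (i : 'I_n) : \forall y \near x, a 0 i < (y : 'rV[R]_n) 0 i < a 0 i + l.
  have /andP[lo hi] := ax i.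
  have cx := @coord_continuous R 1 n 0 i x.
  have lo' := cx _ (lt_nbhsr lo); have hi' := cx _ (lt_nbhsl hi).
  by near=> y; apply/andP; split; near: y.
exact: filter_forall ev.
Unshelve. all: by end_near.
Qed.

(** In each coordinate the two edges are intervals of the same length [l] whose
    left ends are less than [l] apart, so they overlap, and the centre of the
    overlap is interior to both. *)
Lemma interior_cubes_meet a b l A B :
  open_box a l `<=` A -> open_box b l `<=` B ->
  (forall c, `|a 0 c - b 0 c| < l) -> A° `&` B° !=set0.
Proof.
move=> aA bB near_ab.
exists (\row_c ((a 0 c + b 0 c + l) / 2)); split.
- apply: (interiorS aA).
  rewrite (interior_id _).1; last exact: open_box_open.
  move=> c; rewrite mxE; have := near_ab c; rewrite ltr_norml => /andP[? ?].
  by apply/andP; split; lra.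
- apply: (interiorS bB).
  rewrite (interior_id _).1; last exact: open_box_open.
  move=> c; rewrite mxE; have := near_ab c; rewrite ltr_norml => /andP[? ?].
  by apply/andP; split; lra.
Qed.

Definition is_corner l A a := open_box a l `<=` A /\ A `<=` closed_box a l.

(** A colour has to be a function of the cube itself, so that the classes are
    disjoint; hence a corner is chosen once for each set. *)
Definition corner l A : 'rV[R]_n := xget 0 (is_corner l A).

Lemma cornerP l A : cube_of_edge l A -> is_corner l A (corner l A).
Proof. by move=> [_ [a aA]]; exact: (xgetPex 0 (ex_intro _ a aA)). Qed.

(** Multiplying by 2 before dividing turns the dyadic grid of edge [2 ^ (- k)]
    into the grid of half that edge, whose cells are shorter than the cubes. *)
Definition half_cell k a (c : 'I_n) : int := Num.floor (a 0 c * 2 / 2 ^ (- k)).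

Lemma dominated_sub_strip k l A x : l <= 2 ^ (- k) -> cube_of_edge l A ->
  dominated k A x ->
  forall c, let f := Num.floor (corner l A 0 c / 2 ^ (- k)) in
  2 ^ (- k) * f%:~R <= x 0 c < 2 ^ (- k) * (f%:~R + 2).
Proof.
move=> ls cA; have [oA Ac] := cornerP cA; have [l0 _] := cA.
have dA := (dominatedP ls cA (dominated k A)).2 erefl.
by rewrite (is_dominated_block l0 oA Ac dA) => h c; exact: h.
Qed.

(** Each dyadic interval is cut into two halves, the lower one with even index. *)
Lemma half_cell_bounds k a c :
  2 * Num.floor (a 0 c / 2 ^ (- k)) <= half_cell k a c
    <= 2 * Num.floor (a 0 c / 2 ^ (- k)) + 1.
Proof.
rewrite /half_cell mulrAC; set u := a 0 c / _.
have lo : (Num.floor u)%:~R <= u := floor_le u.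
have hi : u < (Num.floor u + 1)%:~R := floorD1_gt u.
move: hi; rewrite intrD => hi.
apply/andP; split.
  by rewrite floor_ge_int intrM /=; lra.
rewrite -ltzD1 floor_lt_int !intrD intrM /=; lra.
Qed.

Lemma half_cell_eq_near k a b c : half_cell k a c = half_cell k b c ->
  `|a 0 c - b 0 c| < 2 ^ (- k) / 2.
Proof.
rewrite /half_cell => e.
have s0 : (0 : R) < 2 ^ (- k) by rewrite exprz_gt0.
have := floor_le (a 0 c * 2 / 2 ^ (- k)); have := floorD1_gt (a 0 c * 2 / 2 ^ (- k)).
have := floor_le (b 0 c * 2 / 2 ^ (- k)); have := floorD1_gt (b 0 c * 2 / 2 ^ (- k)).
rewrite e; set g := Num.floor _; rewrite intrD.
rewrite !ltr_pdivrMr // !ler_pdivlMr // !mulrDl => ? ? ? ?.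
by rewrite ltr_norml; apply/andP; split; lra.
Qed.

(** Half cells congruent modulo 6 but different lie at distance at least 6, so
    the enclosing full cells lie at distance at least 3 > 2, the width of a
    dominated cube in units of [2 ^ (- k)]. *)
Lemma dominated_disjoint k l A B (c : 'I_n) : l <= 2 ^ (- k) ->
  cube_of_edge l A -> cube_of_edge l B ->
  (half_cell k (corner l A) c = half_cell k (corner l B) c %[mod 6])%Z ->
  half_cell k (corner l A) c <> half_cell k (corner l B) c ->
  dominated k A `&` dominated k B = set0.
Proof.
move=> ls cA cB gmod gneq; rewrite -subset0 => x [].
move=> /(dominated_sub_strip ls cA)/(_ c) /=.
move=> /[swap] /(dominated_sub_strip ls cB)/(_ c) /=.
have := half_cell_bounds k (corner l A) c.
have := half_cell_bounds k (corner l B) c.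
have s0 : (0 : R) < 2 ^ (- k) by rewrite exprz_gt0.
set fA := Num.floor (corner l A _ _ / _); set fB := Num.floor (corner l B _ _ / _).
move=> gB gA /andP[xB1 xB2] /andP[xA1 xA2].
have : fA < fB + 2.
  by rewrite -(ltr_int R) intrD -(ltr_pM2l s0); exact: le_lt_trans xA1 xB2.
have : fB < fA + 2.
  by rewrite -(ltr_int R) intrD -(ltr_pM2l s0); exact: le_lt_trans xB1 xA2.
move: gA gB gmod gneq.
move: (half_cell _ _ _) (half_cell _ _ _) fA fB {xA1 xA2 xB1 xB2} => gA gB fA fB.
lia.
Qed.

Definition color k a : {ffun 'I_n -> 'I_6} :=
  [ffun c => inord `|(half_cell k a c %% 6)%Z|%N].

Lemma color_eq k a b : color k a = color k b ->
  forall c, (half_cell k a c = half_cell k b c %[mod 6])%Z.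
Proof.
have res_lt (g : int) : (`|(g %% 6)%Z| < 6)%N by lia.
move=> /ffunP e c; have := congr1 val (e c); rewrite !ffunE /= !inordK //; lia.
Qed.

End CubeGeometry.

Theorem lemma3p10 (R : realType) (n : nat) (hn : (0 < n)%N) (k : int) (l : R)
    (hl : 2 ^ (- k - 1) < l <= 2 ^ (- k)) (Q : nat -> set 'rV[R]_n)
    (hQ : Pi_class l (range Q)) :
  exists F : 'I_(6 ^ n) -> set (set 'rV[R]_n),
    [/\ trivIset setT F,
        range Q = \bigcup_m F m &
        forall m A B, F m A -> F m B -> A <> B ->
          dominated k A `&` dominated k B = set0].
Proof.
have /andP[hl1 hl2] := hl; have [cQ disjQ] := hQ.
have halfE : (2 : R) ^ (- k - 1) = 2 ^ (- k) / 2 by rewrite expfzDr.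
have card_colors : #|{ffun 'I_n -> 'I_6}| = (6 ^ n)%N.
  by rewrite card_ffun !card_ord.
pose idx A : 'I_(6 ^ n) :=
  cast_ord card_colors (enum_rank (color k (corner l A))).
exists (fun m => [set A | range Q A /\ idx A = m]); split.
- by move=> m m' _ _ [A [[_ <-] [_ <-]]].
- apply/seteqP; split=> [A QA|A [m _ []//]].
  by exists (idx A).
- move=> m A B [QA <-] [QB /esym/cast_ord_inj/enum_rank_inj/color_eq gmod] AB.
  have [same_cell|] := pselect (forall c,
      half_cell k (corner l A) c = half_cell k (corner l B) c).
    case: AB; apply: (disjQ _ _ QA QB).
    have [oA _] := cornerP (cQ _ QA); have [oB _] := cornerP (cQ _ QB).
    apply: (interior_cubes_meet oA oB) => c.
    by apply: lt_trans (half_cell_eq_near (same_cell c)) _; rewrite -halfE.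
  move=> /existsNP[c gneq].
  exact: (dominated_disjoint hl2 (cQ _ QA) (cQ _ QB) (gmod c) gneq).
Qed.
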